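(* Let $a$ and $b$ be relatively prime positive integers, let $k \ge 1$ and $m \ge 0$ be integers. Let $R_k(a,b)$ be the set of all nonnegative integers $j$ having exactly $k$ representations $j = pa + qb$ with $(p, q) \in \mathbb{Z}_{\ge 0}^2$, and let $s_k^m(a,b) = \sum_{j \in R_k(a,b)} j^m$. Then \[ s_k^m(a,b) \ = \ \sum_{ \lambda + \mu + \nu = m } \binom{ m }{ \lambda \ \mu \ \nu } a^{ \lambda + \mu } b^{ \lambda + \nu } (k-1)^\lambda \beta_{ \nu + 1 } (a) \, \beta_{ \mu + 1 } (b) \, , \] where the sum is over all triples $(\lambda,\mu,\nu)$ of nonnegative integers with $\lambda+\mu+\nu = m$.
   Context: The number of representations of $j$ is the number of pairs $(p,q) \in \mathbb{Z}_{\ge 0}^2$ with $pa+qb=j$. $\binom{m}{\lambda\ \mu\ \nu} = \frac{m!}{\lambda!\,\mu!\,\nu!}$ is the multinomial coefficient, and $0^0 = 1$. The Bernoulli polynomials $B_n(x)$ are defined by $\frac{z e^{xz}}{e^z - 1} = \sum_{n \ge 0} \frac{B_n(x)}{n!} z^n$, and for $k \ge 1$, $\beta_k(x) := \frac{1}{k}\left(B_k(x) - B_k(0)\right)$; for positive integers $x$ one has $\beta_k(x) = \sum_{j=0}^{x-1} j^{k-1}$ (with $0^0=1$). *)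

(* Defs.v *)
From HB Require Import structures.
From mathcomp Require Import all_boot all_order all_algebra.
From mathcomp Require Import mathcomp_extra boolp classical_sets functions.
From mathcomp Require Import cardinality fsbigop.

Set Implicit Arguments.
Unset Strict Implicit.
Unset Printing Implicit Defensive.

Import GRing.Theory Num.Theory.

Local Open Scope ring_scope.

(* A formal power series \sum_n f_n z^n is the sequence f of its coefficients,
   and fps_mul is the Cauchy product. *)
Definition fps (R : Type) := nat -> R.

Definition fps_mul (R : nzRingType) (f g : fps R) : fps R :=
  fun n => \sum_(i < n.+1) f (n - i)%N * g i.

(* fps_div_coefs f g n lists the first n coefficients of the quotient f / g,
   obtained by solving g * h = f coefficientwise. This is meaningful when g 0
   is a unit (lemma fps_mul_div). *)
Fixpoint fps_div_coefs (R : comUnitRingType) (f g : fps R) (n : nat) : seq R :=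
  if n is n'.+1 then
    let s := fps_div_coefs f g n' in
    rcons s ((f n' - \sum_(i < n') g (n' - i)%N * s`_i) / g 0%N)
  else [::].

Definition fps_div (R : comUnitRingType) (f g : fps R) : fps R :=
  fun n => (fps_div_coefs f g n.+1)`_n.

Lemma size_fps_div_coefs (R : comUnitRingType) (f g : fps R) n :
  size (fps_div_coefs f g n) = n.
Proof. by elim: n => //= n IHn; rewrite size_rcons IHn. Qed.

Lemma nth_fps_div_coefs (R : comUnitRingType) (f g : fps R) n i :
  (i < n)%N -> (fps_div_coefs f g n)`_i = fps_div f g i.
Proof.
elim: n => // n IHn; rewrite ltnS leq_eqVlt => /predU1P[-> //|lt_in].
by rewrite /= nth_rcons size_fps_div_coefs lt_in IHn.
Qed.

Lemma fps_mul_div (R : comUnitRingType) (f g : fps R) :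
  g 0%N \is a GRing.unit -> fps_mul g (fps_div f g) =1 f.
Proof.
move=> g0U n; rewrite /fps_mul big_ord_recr /= subnn.
rewrite {2}/fps_div /= nth_rcons size_fps_div_coefs ltnn eqxx.
rewrite mulrCA mulrV // mulr1 addrC -addrA -[RHS]addr0; congr (_ + _).
rewrite addrC; apply/eqP; rewrite subr_eq0; apply/eqP.
by apply: eq_bigr => i _; rewrite nth_fps_div_coefs.
Qed.

(* e^(x z), as a power series in z over polynomials in the indeterminate x *)
Definition fps_expX : fps {poly rat} := fun n => n`!%:R^-1 *: 'X^n.

(* e^z - 1, with coefficients embedded as constant polynomials *)
Definition fps_expm1 : fps {poly rat} :=
  fun n => if n is 0%N then 0 else n`!%:R^-1%:P.

(* multiplication and division by z (the latter drops the constant term) *)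
Definition fps_mulz (R : nzRingType) (f : fps R) : fps R :=
  fun n => if n is n'.+1 then f n' else 0.

Definition fps_divz (R : Type) (f : fps R) : fps R := fun n => f n.+1.

(* The Bernoulli polynomials B_n(x), given by
     \sum_n B_n(x) z^n / n! = z e^(x z) / (e^z - 1) = e^(x z) / ((e^z - 1) / z).
   The factor z is cancelled because e^z - 1 has no constant term, whereas
   (e^z - 1) / z has constant term 1. *)
Definition bernoulli_poly (n : nat) : {poly rat} :=
  n`!%:R *: fps_div fps_expX (fps_divz fps_expm1) n.

(* The generating function identity in the form
     (e^z - 1) * \sum_n B_n(x) z^n / n! = z e^(x z). *)
Lemma bernoulli_poly_genfun :
  fps_mul fps_expm1 (fun n => n`!%:R^-1 *: bernoulli_poly n)
  =1 fps_mulz fps_expX.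
Proof.
have factK n : n`!%:R^-1 *: bernoulli_poly n
    = fps_div fps_expX (fps_divz fps_expm1) n.
  by rewrite /bernoulli_poly scalerA mulVf ?scale1r // pnatr_eq0 -lt0n fact_gt0.
case=> [|n]; first by rewrite /fps_mul big_ord1 /= mul0r.
rewrite /fps_mul big_ord_recr /= subnn mul0r addr0.
rewrite -(@fps_mul_div _ fps_expX (fps_divz fps_expm1)); last first.
  by rewrite /fps_divz /fps_expm1 factS fact0 muln1 invr1 unitr1.
by apply: eq_bigr => i _; rewrite factK subSn // -ltnS.
Qed.

Definition beta (k : nat) (x : rat) : rat :=
  k%:R^-1 * ((bernoulli_poly k).[x] - (bernoulli_poly k).[0]).

Local Open Scope classical_set_scope.
Local Open Scope card_scope.

Definition representations (a b j : nat) : set (nat * nat) :=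
  [set pq | (pq.1 * a + pq.2 * b = j)%N].

Definition num_representable (k a b : nat) : set nat :=
  [set j | representations a b j #= `I_k].

(* The finitely supported sum is 0 by convention on an infinite support, so it
   is the intended sum only together with finite_set (num_representable k a b). *)
Definition power_sum_representable (k m a b : nat) : rat :=
  \sum_(j \in num_representable k a b) (j%:R ^+ m : rat).

Definition trinomial (m l mu nu : nat) : rat :=
  m`!%:R / (l`!%:R * mu`!%:R * nu`!%:R).

(* Main.v *)
(* By coprimality every j is either p a + Q b for a unique p < b and Q >= 0,
   and then its representations are (p + t b, Q - t a) for t <= Q / a, or it
   has none. Hence j has exactly k >= 1 representations if and only if
   j = (k - 1) a b + p a + q b with p < b and q < a, where (p, q) is unique.
   Expanding j^m by the trinomial theorem and summing over p and q separately
   yields the power sums beta_{mu+1}(b) and beta_{nu+1}(a).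
   That beta computes power sums follows from B_n(x + 1) - B_n(x) = n x^(n-1):
   multiplied by (e^z - 1) / z, both sides of the corresponding identity of
   generating functions are e^((x + 1) z). *)

Require Import Defs.
From mathcomp Require Import all_boot all_order all_algebra.
From mathcomp Require Import classical_sets functions cardinality fsbigop.
From mathcomp Require Import zify ring.

Import GRing.Theory Num.Theory.

Local Open Scope ring_scope.

(** Strong induction: coefficient n of the product is [g 0 * f n] plus terms in earlier coefficients
    of [f], and [g 0] can be cancelled. *)
Lemma fps_mulI (R : comUnitRingType) (g f1 f2 : fps R) :
  g 0%N \is a GRing.unit -> fps_mul g f1 =1 fps_mul g f2 -> f1 =1 f2.
Proof.
move=> g0U eq_gf n; have [k] := ubnP n; elim: k n => // k IHk n lt_nk.
have := eq_gf n; rewrite /fps_mul !big_ord_recr /= subnn.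
under eq_bigr => i _ do rewrite IHk ?(leq_trans (ltn_ord i)) //.
by move/addrI/(mulrI g0U).
Qed.

Definition fps_exp (x : rat) : fps rat := fun n => n`!%:R^-1 * x ^+ n.

(** The series (e^z - 1) / z. *)
Definition fps_expm1_divz : fps rat := fun n => n.+1`!%:R^-1.

Definition bernoulli_egf (x : rat) : fps rat :=
  fun n => n`!%:R^-1 * (bernoulli_poly n).[x].

Lemma factq_neq0 n : (n`!%:R : rat) != 0.
Proof. by rewrite pnatr_eq0 -lt0n fact_gt0. Qed.

Lemma bernoulli_egfE x : fps_mul fps_expm1_divz (bernoulli_egf x) =1 fps_exp x.
Proof.
(* Cancelling z shifts the index by one, hence the coefficient n + 1. *)
move=> n; have /(congr1 (horner^~ x)) := bernoulli_poly_genfun n.+1.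
rewrite /fps_mul big_ord_recr /= subnn mul0r addr0 horner_sum.
rewrite /= /fps_expX hornerZ hornerXn => expX_n.
rewrite /fps_mul [RHS]/fps_exp -expX_n.
apply: eq_bigr => i _; rewrite subSn; last by rewrite -ltnS.
by rewrite /fps_expm1 hornerM hornerC hornerZ.
Qed.

Lemma inv_fact_bin n i : (i <= n)%N ->
  (n`!%:R^-1 * 'C(n, i)%:R : rat) = (n - i)`!%:R^-1 * i`!%:R^-1.
Proof.
move=> le_in; rewrite -(bin_fact le_in) !natrM.
have Cn0 : ('C(n, i)%:R : rat) != 0 by rewrite pnatr_eq0 -lt0n bin_gt0.
by field; rewrite Cn0 !factq_neq0.
Qed.

Lemma fps_exp_add1 x n :
  fps_exp (x + 1) n = \sum_(i < n.+1) (n - i)`!%:R^-1 * fps_exp x i.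
Proof.
rewrite /fps_exp addrC exprDn mulr_sumr; apply: eq_bigr => i _.
rewrite expr1n mul1r -[_ *+ 'C(_, _)]mulr_natl [LHS]mulrA inv_fact_bin ?mulrA //.
by rewrite -ltnS.
Qed.

Lemma bernoulli_egf_add1 x :
  bernoulli_egf (x + 1)
  =1 (fun n => bernoulli_egf x n + fps_mulz (fps_exp x) n).
Proof.
apply: (@fps_mulI _ fps_expm1_divz); first by rewrite /fps_expm1_divz invr1.
move=> n; rewrite bernoulli_egfE fps_exp_add1 /fps_mul.
under [RHS]eq_bigr => i _ do rewrite mulrDr.
rewrite big_split /= -/(fps_mul _ _ n) bernoulli_egfE.
(* This is e^((x + 1) z) = e^(x z) + (e^z - 1) e^(x z): the term i = n on the left gives the first
   summand, and [fps_mulz] shifts the index in the second. *)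
rewrite [LHS]big_ord_recr [in RHS]big_ord_recl /= mulr0 add0r.
rewrite subnn invr1 mul1r addrC.
congr (_ + _); apply: eq_bigr => i _; rewrite /fps_expm1_divz /bump /= add1n.
by rewrite subnSK.
Qed.

Lemma betaE n x : beta n.+1 x%:R = \sum_(i < x) i%:R ^+ n.
Proof.
elim: x => [|x IHx]; first by rewrite big_ord0 /beta subrr mulr0.
rewrite big_ord_recr -IHx /beta -[x.+1%:R]natr1.
(* Scaled by (n + 1)!, this coefficient reads B_{n+1}(x + 1) = B_{n+1}(x) + (n + 1) x^n. *)
have /(congr1 ( *%R n.+1`!%:R)) := bernoulli_egf_add1 x%:R n.+1.
rewrite /bernoulli_egf /= /fps_exp mulrDr !mulVKf ?factq_neq0 // => ->.
rewrite factS natrM; have := factq_neq0 n.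
have : (n.+1%:R : rat) != 0 by rewrite pnatr_eq0.
by move=> n1 nf; field; rewrite nf nat1r n1.
Qed.

Lemma expr_add3n (x y z : rat) m :
  (x + y + z) ^+ m =
  \sum_(l < m.+1) \sum_(mu < m.+1) \sum_(nu < m.+1 | (l + mu + nu == m)%N)
    trinomial m l mu nu * x ^+ l * y ^+ mu * z ^+ nu.
Proof.
rewrite -addrA addrC exprDn; apply: eq_bigr => l _.
have le_lm : (l <= m)%N by rewrite -ltnS.
(* The constraint leaves only nu = m - l - mu, and no nu at all when mu > m - l. *)
transitivity (\sum_(mu < m.+1 | (mu < (m - l).+1)%N)
    trinomial m l mu (m - l - mu) * x ^+ l * y ^+ mu * z ^+ (m - l - mu)).
  rewrite -(big_ord_widen m.+1 (fun mu => trinomial m l mu (m - l - mu)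
      * x ^+ l * y ^+ mu * z ^+ (m - l - mu))); last by lia.
  rewrite addrC exprDn mulr_suml -sumrMnl; apply: eq_bigr => mu _.
  have le_mu : (mu <= m - l)%N by rewrite -ltnS.
  rewrite -mulr_natl -[_ *+ 'C(_, _)]mulr_natl /trinomial.
  rewrite -(bin_fact le_lm) -(bin_fact le_mu) !natrM.
  by field; rewrite !factq_neq0.
rewrite big_mkcond; apply: eq_bigr => mu _; case: ltnP => lt_mu; last first.
  by rewrite big_pred0 // => nu; apply/eqP; lia.
have lt_nu : (m - l - mu < m.+1)%N by lia.
rewrite (big_pred1 (Ordinal lt_nu)) // => nu.
by apply/eqP/eqP => [?|->]; [apply: val_inj|]; rewrite /=; lia.
Qed.

(** Modulo b the equation becomes p a = s a; coprimality allows cancelling a, and residues below b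
    are equal once congruent. *)
Lemma coprime_repr_inj {a b p q s t : nat} : coprime a b ->
  (p < b)%N -> (s < b)%N -> (p * a + q * b = s * a + t * b)%N ->
  p = s /\ q = t.
Proof.
move=> cop_ab lt_pb lt_sb eq_j; have b_gt0 : (0 < b)%N by lia.
have eq_ps : p = s.
  rewrite -(modn_small lt_pb) -(modn_small lt_sb); apply/eqP.
  wlog le_sp : p q s t lt_pb lt_sb eq_j / (s <= p)%N => [wlg|].
    case/orP: (leq_total s p) => ?; first exact: (wlg p q s t).
    by rewrite eq_sym; apply: (wlg s t p q).
  rewrite eqn_mod_dvd // -(@Gauss_dvdl _ _ a) 1?coprime_sym //.
  apply/dvdnP; exists (t - q)%N; rewrite !mulnBl; lia.
split=> //; apply/eqP; rewrite -(eqn_pmul2r b_gt0); apply/eqP.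
by move: eq_j; rewrite eq_ps => /addnI.
Qed.

Local Open Scope classical_set_scope.
Local Open Scope card_scope.

Lemma card_representations {a b p q : nat} :
  (0 < a)%N -> coprime a b -> (p < b)%N ->
  representations a b (p * a + q * b) #= `I_(q %/ a).+1.
Proof.
move=> a_gt0 cop_ab lt_pb; have b_gt0 : (0 < b)%N by lia.
(* The truncated subtraction is exact because t <= q / a. *)
pose f t := ((p + t * b)%N, (q - t * a)%N).
have -> : representations a b (p * a + q * b) = [set f t | t in `I_(q %/ a).+1].
  apply/seteqP; split=> [[r s] /= eq_j|_ [t /= lt_t <-]]; last first.
    have le_ta : (t * a <= q)%N by rewrite -leq_divRL.
    rewrite /representations /f /= mulnDl mulnBl -addnA (mulnAC t b a).
    congr (_ + _)%N; rewrite subnKC // leq_mul2r le_ta orbT //.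
  (* Moving the multiple of b in r over to the other coefficient reduces (r, s) to (p, q) by
     uniqueness, so t = r / b. *)
  move: eq_j; rewrite /representations /= {1}(divn_eq r b) mulnDl.
  have -> : ((r %/ b * b * a + r %% b * a + s * b)
           = r %% b * a + (r %/ b * a + s) * b)%N by lia.
  move/(coprime_repr_inj cop_ab (ltn_pmod r b_gt0) lt_pb) => -[].
  rewrite /f => <- <-.
  exists (r %/ b)%N; first by rewrite ltnS leq_divRL // leq_addr.
  by rewrite addKn addnC -divn_eq.
apply: inj_card_eq => t u _ _ [/addnI/eqP + _].
by rewrite eqn_pmul2r // => /eqP.
Qed.

Lemma num_representableE {a b k : nat} :
  (0 < a)%N -> (0 < b)%N -> coprime a b ->
  num_representable k.+1 a b =
  [set (k * (a * b) + pq.1 * a + pq.2 * b)%N | pq in `I_b `*` `I_a].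
Proof.
move=> a_gt0 b_gt0 cop_ab.
apply/seteqP; split=> [j /= card_j|_ [[p q] /= [lt_pb lt_qa] <-]]; last first.
  have -> : (k * (a * b) + p * a + q * b = p * a + (k * a + q) * b)%N by lia.
  rewrite /num_representable /=.
  have := @card_representations a b p (k * a + q) a_gt0 cop_ab lt_pb.
  by rewrite divnMDl // divn_small // addn0.
have [[r s] rs_j] : representations a b j !=set0.
  apply/set0P/eqP => rep0; move: card_j; rewrite /num_representable /= rep0.
  by move/card_esym; rewrite card_eq0 => /eqP/seteqP[/(_ 0%N)] /(_ isT).
(* Reducing the first coefficient below b makes the count q / a + 1 available; it equals k + 1, so q
   = k a + q mod a. *)
pose p := (r %% b)%N; pose q := (r %/ b * a + s)%N.
have lt_pb : (p < b)%N by rewrite ltn_pmod.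
have def_j : j = (p * a + q * b)%N.
  by rewrite -rs_j /= {1}(divn_eq r b) /p /q; lia.
have := @card_representations a b p q a_gt0 cop_ab lt_pb.
rewrite -def_j => /card_esym/card_eq_trans/(_ card_j)/card_eq_II[eq_qa].
exists (p, (q %% a)%N); first by split=> //=; rewrite ltn_pmod.
by rewrite /= def_j [in RHS](divn_eq q a) eq_qa; lia.
Qed.

Local Open Scope ring_scope.

Lemma power_sum_representableE {a b k} m :
  (0 < a)%N -> (0 < b)%N -> coprime a b ->
  power_sum_representable k.+1 m a b =
  \sum_(p < b) \sum_(q < a)
    (k%:R * (a%:R * b%:R) + p%:R * a%:R + q%:R * b%:R) ^+ m.
Proof.
move=> a_gt0 b_gt0 cop_ab; rewrite /power_sum_representable num_representableE //.
(* Injectivity: after cancelling k a b, uniqueness of the reduced representation applies. *)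
rewrite fsbig_image; last first.
  move=> [p q] [s t]; rewrite !inE /= => -[/= lt_pb _] [/= lt_sb _].
  rewrite -!addnA => /addnI /(coprime_repr_inj cop_ab lt_pb lt_sb).
  by case=> -> ->.
under [RHS]eq_bigr => p _.
  rewrite (fsbig_ord _ _ (fun q =>
    (k%:R * (a%:R * b%:R) + p%:R * a%:R + q%:R * b%:R : rat) ^+ m)); over.
rewrite (fsbig_ord _ _ (fun p => \sum_(q \in `I_a)
    (k%:R * (a%:R * b%:R) + p%:R * a%:R + q%:R * b%:R : rat) ^+ m)).
rewrite pair_fsbig; [|exact: finite_II|exact: finite_II].
by apply: eq_fsbigr => pq _; rewrite !natrD !natrM.
Qed.

Theorem theorem4 (a b k m : nat) (ha : (0 < a)%N) (hb : (0 < b)%N)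
    (hab : coprime a b) (hk : (1 <= k)%N) :
  finite_set (num_representable k a b) /\
  power_sum_representable k m a b =
    \sum_(l < m.+1) \sum_(mu < m.+1) \sum_(nu < m.+1 | (l + mu + nu == m)%N)
      trinomial m l mu nu * a%:R ^+ (l + mu) * b%:R ^+ (l + nu)
        * (k%:R - 1) ^+ l * beta nu.+1 a%:R * beta mu.+1 b%:R.
Proof.
case: k hk => // k _; split.
  rewrite num_representableE //; apply/finite_image/finite_setX; exact: finite_II.
rewrite power_sum_representableE //.
under eq_bigr => p _ do under eq_bigr => q _ do rewrite expr_add3n.
under eq_bigr => p _ do rewrite exchange_big.
rewrite exchange_big; apply: eq_bigr => l _.
under eq_bigr => p _ do rewrite exchange_big.
rewrite exchange_big; apply: eq_bigr => mu _.
under eq_bigr => p _ do rewrite exchange_big.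
rewrite exchange_big; apply: eq_bigr => nu _.
(* For fixed exponents the double sum factors: p^mu over p < b gives [beta mu.+1 b], and q^nu over q
   < a gives [beta nu.+1 a]. *)
rewrite !betaE -[RHS]mulrA [X in _ = _ * X]mulrC mulr_suml mulr_sumr.
apply: eq_bigr => p _; rewrite !mulr_sumr; apply: eq_bigr => q _.
by rewrite -natr1 addrK !exprMn !exprD; ring.
Qed.
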